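(* Let $(\Omega,\Sigma,\mu)$ be an arbitrary measure space and set $X=L_1(\mu;\mathbb R)$, with closed unit ball $B_X$. Let $D\subset B_X$ be non-empty, and let $\tau$ be a topology on $D$ containing the relative weak topology of $D$. (i) Let $0<\delta\leq 2$. If every non-empty $\tau$-open subset of $D$ has diameter at least $\delta$, then every finite or countable convex combination of non-empty $\tau$-open subsets of $D$ is wHD-$(\delta/4)$. (ii) If every non-empty $\tau$-open subset of $D$ has diameter two, then every finite or countable convex combination of non-empty $\tau$-open subsets of $D$ is wHD2.
   Context: For a non-empty bounded subset $C$ of a Banach space, $\operatorname{diam}(C)=\sup\{\|x-y\|:x,y\in C\}$. For a real Banach space $Y$ with closed unit ball $B_Y$ and $0<\delta\le 2$, a non-empty set $C\subset B_Y$ is called weakly hereditarily diameter $\delta$ (wHD-$\delta$) if $\operatorname{diam}(C\cap W)\ge\delta$ for every weakly open set $W\subset Y$ with $C\cap W\neq\emptyset$; for $\delta=2$ one writes wHD2. The relative weak topology on $D\subset X$ is the topology induced on $D$ by the weak topology of $X$. A finite or countable convex combination of subsets $U_i\subset B_X$ is a set of the form $\sum_i\lambda_iU_i=\{\sum_i\lambda_iu_i : u_i\in U_i\}$, with $i$ ranging over a finite or countable index set, $\lambda_i\ge0$ and $\sum_i\lambda_i=1$ (series being understood in norm; they converge absolutely since $U_i\subset B_X$). *)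

(* Defs.v *)
From HB Require Import structures.
From mathcomp Require Import all_boot all_order all_algebra.
From mathcomp Require Import all_classical all_reals all_analysis.
From mathcomp Require Import measurable_realfun.

Set Implicit Arguments.
Unset Strict Implicit.
Unset Printing Implicit Defensive.

Import Order.TTheory GRing.Theory Num.Theory.
Import numFieldNormedType.Exports.

Local Open Scope classical_set_scope.
Local Open Scope ring_scope.

(* The library's L^1 space (integrable functions modulo a.e. equality) is only a
   type there; below it receives its vector space structure and its norm
   F |-> \int |F|. *)
Definition L1 d (T : measurableType d) (R : realType)
  (mu : {measure set T -> \bar R}) : Type := LspaceType1 mu.

Section L1.
Context d (T : measurableType d) (R : realType).
Variable mu : {measure set T -> \bar R}.

Local Notation Lfun1 := (LfunType mu (@lexx _ _ 1%E)).
Local Notation mfunR := {mfun T >-> measurableTypeR R}.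
Local Notation qmfun := {mfun_ mu, T >-> measurableTypeR R}.
Implicit Types (f g : Lfun1) (F G H : L1 mu).

Definition L1_fun F : T -> R := (F : LspaceType1 mu).

Lemma L1_fun_Lfun F : L1_fun F \in Lfun mu 1%E.
Proof.
rewrite inE; apply/andP; split; rewrite inE /=.
  have := @measurable_funPT _ _ T (measurableTypeR R) (repr (F : qmfun)).
  exact.
exact: (@Lebesgue_finite _ _ _ _ _ _ (F : LspaceType1 mu)).
Qed.

Definition L1_repr F : Lfun1 := Lfun_Sub (@lexx _ _ 1%E) (L1_fun_Lfun F).

Lemma Lfun1_mfun f : (f : T -> R) \in @mfun _ _ T (measurableTypeR R).
Proof. by rewrite inE /=; exact: (@measurable_funPT _ _ T R f). Qed.

Definition mfun_of_Lfun1 f : mfunR :=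
  @mfun_Sub _ _ T (measurableTypeR R) f (Lfun1_mfun f).

Definition qmfun_of_Lfun1 f : qmfun := (\pi_(qmfun) (mfun_of_Lfun1 f))%qT.

Lemma qmfun_of_Lfun1_ae f : (qmfun_of_Lfun1 f : T -> R) = f %[ae mu].
Proof.
have /eqP := reprK (qmfun_of_Lfun1 f).
by rewrite eqmodE => /asboolP.
Qed.

Lemma ae_eq_Lnorm1 (u v : T -> R) :
  measurable_fun setT u -> measurable_fun setT v -> u = v %[ae mu] ->
  'N[mu]_1[EFin \o u]%E = 'N[mu]_1[EFin \o v]%E.
Proof.
move=> mu' mv uv; rewrite !Lnorm1; apply: ge0_ae_eq_integral => //.
- by apply: measurableT_comp => //; exact/measurable_EFinP.
- by apply: measurableT_comp => //; exact/measurable_EFinP.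
- by apply: filterS uv => x /[apply] /= ->.
Qed.

Lemma qmfun_of_Lfun1_finite f : finite_norm mu 1 (qmfun_of_Lfun1 f).
Proof.
rewrite /finite_norm (@ae_eq_Lnorm1 _ f) //.
- exact: Lfunction_finite.
- exact: (@measurable_funPT _ _ T (measurableTypeR R) (repr (qmfun_of_Lfun1 f))).
- exact: qmfun_of_Lfun1_ae.
Qed.

Definition L1_pi f : L1 mu :=
  LebesgueSpace.Pack (LebesgueSpace.Class
    (isFinLebesgue.Build _ _ _ _ _ (@lexx _ _ 1%E) _ (qmfun_of_Lfun1_finite f))).

Lemma L1_pi_ae f : L1_repr (L1_pi f) = f %[ae mu].
Proof. exact: qmfun_of_Lfun1_ae. Qed.

Lemma L1_eqP F G : L1_repr F = L1_repr G %[ae mu] <-> F = G.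
Proof.
split=> [|->]; last exact: ae_eq_refl.
case: F => F [[hF]]; case: G => G [[hG]] FG.
have FG' : F = G.
  rewrite -(reprK F) -(reprK G); apply/eqP; rewrite eqmodE; exact/asboolP.
case: _ / FG' in hG FG *.
by rewrite (Prop_irrelevance hF hG).
Qed.

Lemma L1_piP f g : f = g %[ae mu] <-> L1_pi f = L1_pi g.
Proof.
rewrite -L1_eqP; split=> fg.
  apply: (ae_eq_trans (L1_pi_ae f)); apply: (ae_eq_trans fg).
  exact/ae_eq_sym/L1_pi_ae.
apply: (ae_eq_trans (ae_eq_sym (L1_pi_ae f))).
exact/(ae_eq_trans fg)/L1_pi_ae.
Qed.

Lemma L1_reprK F : L1_pi (L1_repr F) = F.
Proof. by apply/L1_eqP; exact: L1_pi_ae. Qed.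

Definition L1_zero : L1 mu := L1_pi 0.
Definition L1_opp F : L1 mu := L1_pi (- L1_repr F).
Definition L1_add F G : L1 mu := L1_pi (L1_repr F + L1_repr G).
Definition L1_scale (a : R) F : L1 mu := L1_pi (a *: L1_repr F).
Definition L1_norm F : R := fine 'N[mu]_1[EFin \o L1_repr F]%E.

Lemma L1_pi_add f g : L1_add (L1_pi f) (L1_pi g) = L1_pi (f + g).
Proof.
apply/L1_piP; move: (L1_pi_ae f) (L1_pi_ae g).
by apply: filterS2 => x fx gx xT; exact: (congr2 +%R (fx xT) (gx xT)).
Qed.

Lemma L1_pi_opp f : L1_opp (L1_pi f) = L1_pi (- f).
Proof.
by apply/L1_piP; move: (L1_pi_ae f); apply: filterS => x fx xT; exact: (congr1 -%R (fx xT)).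
Qed.

Lemma L1_pi_scale a f : L1_scale a (L1_pi f) = L1_pi (a *: f).
Proof.
by apply/L1_piP; move: (L1_pi_ae f); apply: filterS => x fx xT; exact: (congr1 ( *%R a) (fx xT)).
Qed.

Lemma L1_pi_norm f : L1_norm (L1_pi f) = fine 'N[mu]_1[EFin \o f]%E.
Proof.
by congr fine; apply: ae_eq_Lnorm1 => //; exact: L1_pi_ae.
Qed.

HB.instance Definition _ := gen_eqMixin (L1 mu).
HB.instance Definition _ := gen_choiceMixin (L1 mu).

Lemma L1_addA : associative L1_add.
Proof.
move=> F G H; rewrite -(L1_reprK F) -(L1_reprK G) -(L1_reprK H).
by rewrite !L1_pi_add addrA.
Qed.

Lemma L1_addC : commutative L1_add.
Proof. by move=> F G; rewrite /L1_add addrC. Qed.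

Lemma L1_add0 : left_id L1_zero L1_add.
Proof. by move=> F; rewrite -(L1_reprK F) L1_pi_add add0r. Qed.

Lemma L1_addN : left_inverse L1_zero L1_opp L1_add.
Proof. by move=> F; rewrite -(L1_reprK F) L1_pi_opp L1_pi_add addNr. Qed.

HB.instance Definition _ :=
  GRing.isZmodule.Build (L1 mu) L1_addA L1_addC L1_add0 L1_addN.

Lemma L1_scaleA a b F : L1_scale a (L1_scale b F) = L1_scale (a * b) F.
Proof. by rewrite -(L1_reprK F) !L1_pi_scale scalerA. Qed.

Lemma L1_scale1 : left_id 1 L1_scale.
Proof. by move=> F; rewrite -(L1_reprK F) L1_pi_scale scale1r. Qed.

Lemma L1_scaleDr : right_distributive L1_scale +%R.
Proof.
move=> a F G; rewrite -(L1_reprK F) -(L1_reprK G) -[_ + _]/(L1_add _ _).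
by rewrite L1_pi_add !L1_pi_scale scalerDr -L1_pi_add.
Qed.

Lemma L1_scaleDl F : {morph L1_scale^~ F : a b / a + b}.
Proof.
move=> a b; rewrite -(L1_reprK F).
by rewrite !L1_pi_scale scalerDl -L1_pi_add.
Qed.

HB.instance Definition _ := GRing.Zmodule_isLmodule.Build R (L1 mu)
  L1_scaleA L1_scale1 L1_scaleDr L1_scaleDl.

Lemma L1_normD F G : L1_norm (F + G) <= L1_norm F + L1_norm G.
Proof. by rewrite [leLHS]L1_pi_norm ler_LnormD. Qed.

Lemma L1_normZ (a : R) F : L1_norm (a *: F) = `|a| * L1_norm F.
Proof.
rewrite [LHS]L1_pi_norm /L1_norm; apply: EFin_inj.
by rewrite EFinM !finite_norm_fine -LnormZ.
Qed.

Lemma L1_norm0_eq0 F : L1_norm F = 0 -> F = 0.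
Proof.
move=> /fine_Lnormr_eq0 F0; apply/L1_eqP; apply: (ae_eq_trans F0).
exact/ae_eq_sym/L1_pi_ae.
Qed.

HB.instance Definition _ :=
  Lmodule_isNormed.Build R (L1 mu) L1_normD L1_normZ L1_norm0_eq0.

Lemma L1_normE F : `|F| = fine (\int[mu]_x `|(L1_fun F x)%:E|)%E.
Proof. by rewrite -Lnorm1. Qed.

End L1.


Section Banach.
Context (R : realType) (V : normedModType R).

Definition dual := {f : {linear V -> R^o} | continuous (f : V -> R^o)}.

Definition weak_topology : Type := sup_topology (fun f : dual =>
  Topological.class (initial_topology (sval f : V -> R^o))).
HB.instance Definition _ := Topological.copy weak_topology
  (sup_topology (fun f : dual =>
    Topological.class (initial_topology (sval f : V -> R^o)))).

Definition weakly_open (W : set V) := open (W : set weak_topology).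

Definition unit_ball : set V := [set x | `|x| <= 1].

(* A real-valued supremum: meaningful for non-empty bounded C only. *)
Definition diam (C : set V) : R := sup [set `|x.1 - x.2| | x in C `*` C].

Definition wHD (delta : R) (C : set V) :=
  [/\ C !=set0, C `<=` unit_ball &
    forall W, weakly_open W -> C `&` W !=set0 -> delta <= diam (C `&` W)].

Definition finite_convex_combination (F : set_system V) (C : set V) :=
  exists (n : nat) (lambda : 'I_n -> R) (U : 'I_n -> set V),
    [/\ forall i, F (U i), forall i, 0 <= lambda i, \sum_i lambda i = 1 &
      C = [set x | exists2 u : 'I_n -> V, forall i, U i (u i) &
                     x = \sum_i lambda i *: u i]].

Definition countable_convex_combination (F : set_system V) (C : set V) :=
  exists (lambda : R^nat) (U : nat -> set V),
    [/\ forall i, F (U i), forall i, 0 <= lambda i,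
        series lambda @ \oo --> (1 : R) &
      C = [set x | exists2 u : V^nat, forall i, U i (u i) &
                     series (fun i => lambda i *: u i) @ \oo --> x]].

(* Index sets {0, ..., n-1} and nat cover all finite or countable ones: the series
   converge absolutely when the members of F lie in the unit ball. *)
Definition convex_combination (F : set_system V) (C : set V) :=
  finite_convex_combination F C \/ countable_convex_combination F C.

Section RelativeTopology.
Variables (D : set V) (tau : Topological D).

Definition relative_weak_topology : topologicalType :=
  set_type (D : set weak_topology).

Definition contains_relative_weak_topology :=
  @open relative_weak_topology `<=` @open (Topological.Pack tau).

(* Non-empty tau-open subsets of D, seen as subsets of V. *)
Definition nonempty_open : set_system V :=
  [set U | U !=set0 /\
    exists2 O : set D, @open (Topological.Pack tau) O & U = set_val @` O].

End RelativeTopology.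
End Banach.

Arguments unit_ball {R V}.

(* Main.v *)
(* Perturbing finitely many coordinates of a point of the convex combination
   within weak neighbourhoods reduces everything to making the norm of a finite
   sum \sum_i lam_i *: (w_i - w'_i) large, with w_i and w'_i in given tau-open
   sets V_i. We choose w_i - w'_i almost disjoint from a given g in L_1, namely
   the part of the sum already built. To this end, let u in V nearly maximise
   the convex functional v |-> \int sqrt (v^2 + g^2) over V. Its subgradient
   u / sqrt (u^2 + g^2) at u is bounded by 1, hence is a continuous functional,
   and every w in V at which it is close to its value at u has a small Bregman
   divergence from u, so that min(|w - u|, |g|) has a small integral. Since that
   weak neighbourhood of u in V still has diameter at least delta, it contains w
   and w' with |w - w'| >= delta - eps and w - w' almost disjoint from g.
   This yields wHD-delta for every delta, which contains both (i) and (ii). The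
   joint homogeneity of sqrt (v^2 + g^2) makes sigma-finiteness unnecessary. *)

Require Import Defs.
From HB Require Import structures.
From mathcomp Require Import all_boot all_order all_algebra.
From mathcomp Require Import all_classical all_reals all_analysis.
From mathcomp Require Import measurable_realfun ring lra.

Set Implicit Arguments.
Unset Strict Implicit.
Unset Printing Implicit Defensive.

Import Order.TTheory GRing.Theory Num.Theory.
Import numFieldNormedType.Exports.

Local Open Scope classical_set_scope.
Local Open Scope ring_scope.

(** * Weak neighbourhoods *)

Section WeakTopology.
Context (R : realType) (V : normedModType R).
Implicit Types (s : seq (dual V)) (x y : V).

(** Balls of these seminorms are the basic weak neighbourhoods. With a sum over a list,
    concatenating two lists gives a seminorm that dominates both. *)
Definition weak_seminorm s y : R := \sum_(f <- s) `|sval f y|.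

Lemma weak_seminormD s x y :
  weak_seminorm s (x + y) <= weak_seminorm s x + weak_seminorm s y.
Proof.
rewrite /weak_seminorm -big_split /=; apply: ler_sum => f _.
by rewrite linearD ler_normD.
Qed.

Lemma weak_seminormZ s a y :
  weak_seminorm s (a *: y) = `|a| * weak_seminorm s y.
Proof.
rewrite /weak_seminorm mulr_sumr; apply: eq_bigr => f _.
by rewrite linearZ /= normrM.
Qed.

Lemma weak_seminorm0 s : weak_seminorm s 0 = 0.
Proof. by rewrite -[0 in LHS](scale0r 0) weak_seminormZ normr0 mul0r. Qed.

Lemma weak_seminorm_ge0 s y : 0 <= weak_seminorm s y.
Proof. by apply: sumr_ge0 => f _. Qed.

Lemma weak_seminorm_sum s n (h : nat -> V) :
  weak_seminorm s (\sum_(i < n) h i) <= \sum_(i < n) weak_seminorm s (h i).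
Proof.
elim: n => [|n IH]; first by rewrite !big_ord0 weak_seminorm0.
by rewrite !big_ord_recr /= (le_trans (weak_seminormD _ _ _))// lerD2r.
Qed.

Lemma weak_dual_continuous (f : dual V) :
  continuous (sval f : weak_topology V -> R^o).
Proof.
move=> x A Ax.
have /cvg_sup/(_ f) :
  nbhs (x : weak_topology V) --> (x : weak_topology V) by [].
by apply; exact: (@initial_continuous _ _ (sval f : V -> R^o) x A Ax).
Qed.

Lemma weak_seminorm_continuous s x :
  continuous ((fun y => weak_seminorm s (y - x)) : weak_topology V -> R^o).
Proof.
have -> : (fun y => weak_seminorm s (y - x)) =
    (fun y => \sum_(f <- s) `|sval f y - sval f x|).
  by apply/funext => y; apply: eq_bigr => f _; rewrite linearB.
move=> y; elim: s => [|f s IH].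
  rewrite [X in continuous_at _ X](_ : _ = cst 0).
    exact: cst_continuous.
  by apply/funext => z; rewrite big_nil.
rewrite [X in continuous_at _ X](_ : _ =
    (fun y => `|sval f y - sval f x| + \sum_(g <- s) `|sval g y - sval g x|)).
  2: by apply/funext => z; rewrite big_cons.
apply: continuousD IH; apply: continuous_comp (@norm_continuous _ R^o _).
apply: continuousB; first exact: weak_dual_continuous.
exact: cst_continuous.
Qed.

Lemma weak_ball_open s x e : weakly_open [set y | weak_seminorm s (y - x) < e].
Proof.
have /continuousP := @weak_seminorm_continuous s x.
by move=> /(_ [set t | t < e]); apply; exact: open_lt.
Qed.

(** The sets containing a seminorm ball around [x] form a filter. It converges to [x] in the initial
    topology of each functional, hence in their supremum, so it contains every weakly open set
    around [x]. *)
Lemma weakly_openP (W : set V) x : weakly_open W -> W x ->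
  exists s e, 0 < e /\ [set y | weak_seminorm s (y - x) < e] `<=` W.
Proof.
move=> oW Wx.
pose F : set_system V := [set A | exists s e, 0 < e /\
  [set y | weak_seminorm s (y - x) < e] `<=` A].
have FF : Filter F.
  split.
  - by exists [::], 1; split.
  - move=> A B [s [e [e0 sA]]] [t [e' [e'0 tB]]].
    exists (s ++ t), (Num.min e e'); split; first by rewrite lt_min e0.
    move=> y /=; rewrite /weak_seminorm big_cat /= lt_min => /andP[ye ye'].
    have sy := weak_seminorm_ge0 s (y - x).
    have ty := weak_seminorm_ge0 t (y - x).
    split; [apply: sA|apply: tB]; rewrite /= /weak_seminorm.
      by apply: le_lt_trans ye; rewrite lerDl.
    by apply: le_lt_trans ye'; rewrite lerDr.
  - move=> A B AB [s [e [e0 sA]]]; exists s, e; split => //.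
    exact: subset_trans AB.
suff Fx : F --> (x : weak_topology V) by apply: Fx; exact: open_nbhs_nbhs.
apply/cvg_sup => f A [_ [[B oB <-] Bx BA]].
have /nbhs_ballP[e /= e0 eB] : nbhs (sval f x : R^o) B by exact: open_nbhs_nbhs.
exists [:: f], e; split => // y /=; rewrite /weak_seminorm big_seq1 => yx.
apply: BA => /=; apply: eB; rewrite /ball /=.
by rewrite distrC -linearB.
Qed.

End WeakTopology.

(** * Weak balls inside tau-open sets *)

Section NonemptyOpen.
Context (R : realType) (V : normedModType R) (D : set V) (tau : Topological D).
Hypothesis tau_weak : contains_relative_weak_topology tau.

Lemma nonempty_open_sub (U : set V) : nonempty_open tau U -> U `<=` D.
Proof. by move=> [_ [A _ ->]] _ [x _ <-]; exact: set_mem (valP x). Qed.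

(** Here the inclusion of the relative weak topology in [tau] enters: cutting a tau-open set by a
    weak ball keeps it tau-open, and the centre keeps it non-empty. *)
Lemma nonempty_open_weak_ball U u s e : nonempty_open tau U -> U u -> 0 < e ->
  nonempty_open tau (U `&` [set y | weak_seminorm s (y - u) < e]).
Proof.
move=> [_ [A oA ->]] Au e0; set B := [set y | _]; split.
  by exists u; split => //; rewrite /B/= subrr weak_seminorm0.
exists (A `&` set_val @^-1` B).
  apply: openI => //; apply: tau_weak.
  by exists B => //; exact: weak_ball_open.
apply/seteqP; split => y.
  by move=> [[z Az <-] Bz]; exists z.
by move=> [z [Az Bz] <-]; split => //; exists z.
Qed.

End NonemptyOpen.

(** * Convex combinations *)

Section Series.
Context (R : realType) (V : normedModType R).
Implicit Types f g : V^nat.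

Lemma cvg_series_finite f n : (forall i, (n <= i)%N -> f i = 0) ->
  series f @ \oo --> \sum_(i < n) f i.
Proof.
move=> f0; apply: cvg_near_cst; near=> m.
have nm : (n <= m)%N by near: m; exact: nbhs_infty_ge.
rewrite /series /= -(big_mkord xpredT f) (@big_cat_nat _ _ _ n) //=.
rewrite [X in _ + X]big1_seq ?addr0// => i /andP[_].
by rewrite mem_index_iota => /andP[/f0].
Unshelve. all: by end_near. Qed.

(** Used to perturb finitely many coordinates of a point of the combination while its tail stays
    fixed. *)
Lemma cvg_series_modify f g n x : (forall i, (n <= i)%N -> g i = f i) ->
  series f @ \oo --> x ->
  series g @ \oo --> x + \sum_(i < n) (g i - f i).
Proof.
move=> gf fx.
have gfn : series (fun i => g i - f i) @ \oo --> \sum_(i < n) (g i - f i).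
  by apply: cvg_series_finite => i /gf ->; rewrite subrr.
rewrite (_ : series g = series f \+ series (fun i => g i - f i)).
  exact: cvgD.
apply/funext => m /=; rewrite /series /= -big_split /=.
by apply: eq_bigr => i _; rewrite subrKC.
Qed.

Lemma series_nneg_le (lam : R^nat) (l : R) n : (forall i, 0 <= lam i) ->
  series lam @ \oo --> l -> \sum_(i < n) lam i <= l.
Proof.
move=> lam0 laml; rewrite -(cvg_lim _ laml)//.
rewrite -(big_mkord xpredT lam) -[leLHS]/(series lam n).
apply: nondecreasing_cvgn_le; last by apply/cvg_ex; exists l.
apply/nondecreasing_seqP => m.
by rewrite /series /= big_nat_recr //= lerDl.
Qed.

End Series.

Lemma finite_convex_combination_countable (R : realType) (V : normedModType R)
    (F : set_system V) (C : set V) :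
  finite_convex_combination F C -> countable_convex_combination F C.
Proof.
move=> [n [lam [U [FU lam0 lam1 ->]]]].
(* The empty combination is excluded, since its weights sum to 0. A successor bound makes [inord]
   available. *)
case: n lam U FU lam0 lam1 => [|n] lam U FU lam0 lam1.
  by move: lam1; rewrite big_ord0 => /esym/eqP; rewrite oner_eq0.
pose lam' i := if (i < n.+1)%N then lam (inord i) else 0.
have lam'E (i : 'I_n.+1) : lam' i = lam i by rewrite /lam' ltn_ord inord_val.
have sumE (u : V^nat) :
    series (fun i => lam' i *: u i) @ \oo --> \sum_(i < n.+1) lam i *: u i.
  under eq_bigr do rewrite -lam'E.
  apply: (@cvg_series_finite _ _ (fun i => lam' i *: u i)) => i ni.
  by rewrite /lam' ltnNge ni scale0r.
(* Beyond the range, [inord i] falls back to index 0; the choice is harmless because the weight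
   there is 0. *)
exists lam', (fun i => U (inord i)); split => [i|i||].
- exact: FU.
- by rewrite /lam'; case: ifP.
- rewrite -lam1; under eq_bigr do rewrite -lam'E.
  apply: (@cvg_series_finite _ R^o lam') => i ni.
  by rewrite /lam' ltnNge ni.
apply/seteqP; split => x /= [u Uu].
  move=> ->; exists (fun i => u (inord i)) => //.
  rewrite (eq_bigr (fun i : 'I_n.+1 => lam i *: u (inord i))).
    exact: sumE.
  by move=> i _; rewrite inord_val.
move=> ux; exists (fun i : 'I_n.+1 => u i).
  by move=> i; have := Uu i; rewrite inord_val.
by have := sumE u => /cvg_lim <- //; apply/esym/cvg_lim.
Qed.

(** * From norm spreading to wHD convex combinations *)

Section SpreadCombinations.
Context (R : realType) (V : normedModType R) (D : set V) (tau : Topological D).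
Variable delta : R.
Hypothesis D_ball : D `<=` unit_ball.
Hypothesis tau_weak : contains_relative_weak_topology tau.

(** The geometric input, supplied for L1 by [L1_spread]: every tau-open set contains differences
    that are almost norm-additive with a prescribed vector. *)
Hypothesis spread : forall U, nonempty_open tau U ->
  forall (g : V) (lam eps : R), 0 <= lam <= 1 -> 0 < eps ->
  exists w w', [/\ U w, U w' &
    `|g| + lam * delta - eps <= `|g + lam *: (w - w')|].

(** The completeness input, supplied for L1 by [L1_convex_series_cvg]; it makes countable
    combinations non-empty. *)
Hypothesis convex_series_cvg : forall (lam : R^nat) (u : V^nat),
  (forall i, 0 <= lam i) -> series lam @ \oo --> (1 : R) ->
  (forall i, unit_ball (u i)) ->
  cvgn (series (fun i => lam i *: u i)).

(** Induction on [n]: the sum already built plays the role of [g] in [spread], and each new term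
    loses at most [eps]. *)
Lemma spread_sum (U : nat -> set V) (lam : R^nat) eps n :
  (forall i, nonempty_open tau (U i)) -> (forall i, 0 <= lam i <= 1) ->
  0 < eps ->
  exists w w', [/\ forall i, U i (w i), forall i, U i (w' i) &
    \sum_(i < n) lam i * delta - eps *+ n <=
    `|\sum_(i < n) lam i *: (w i - w' i)|].
Proof.
move=> oU lam01 eps0; elim: n => [|n [w [w' [Uw Uw' ww']]]].
  have [w Uw] : {w : nat -> V & forall i, U i (w i)}.
    by apply: (@choice nat V (fun i x => U i x)) => i; have [] := oU i.
  by exists w, w; split => //; rewrite !big_ord0 mulr0n subr0 normr0.
have [v [v' [Uv Uv' vv']]] :=
  spread (oU n) (\sum_(i < n) lam i *: (w i - w' i)) (lam01 n) eps0.
exists (fun i => if i == n then v else w i).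
exists (fun i => if i == n then v' else w' i).
split => [i|i|]; [by case: eqP => [->|]|by case: eqP => [->|]|].
rewrite !big_ord_recr /= eqxx.
under [in leRHS]eq_bigr do rewrite ltn_eqF//.
by apply: le_trans vv'; rewrite mulrS opprD addrACA addrAC; lra.
Qed.

Lemma diam_ge (A : set V) (x y : V) : A `<=` unit_ball -> A x -> A y ->
  `|x - y| <= diam A.
Proof.
move=> A1 Ax Ay; apply: ub_le_sup; last by exists (x, y).
exists 2 => _ [[a b] [/A1 /= a1 /A1 /= b1] <-].
by rewrite (le_trans (ler_normB _ _))// -[2]/(1 + 1) lerD.
Qed.

(** Around a point of the combination in [W], the first [N] coordinates may move in small weak balls
    without leaving [W]. Once these carry almost all the weight, [spread_sum] provides two such
    perturbations nearly [delta] apart. *)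
Lemma countable_convex_combination_wHD C :
  countable_convex_combination (nonempty_open tau) C -> wHD delta C.
Proof.
move=> [lam [U [oU lam0 lam1 ->]]]; set C' := [set x | _].
have UB i : U i `<=` unit_ball.
  by apply: subset_trans D_ball; apply: nonempty_open_sub (oU i).
have lam01 i : 0 <= lam i <= 1.
  rewrite lam0 /= (le_trans _ (series_nneg_le i.+1 lam0 lam1))//.
  by rewrite big_ord_recr /= lerDr sumr_ge0.
(* Partial sums have norm at most the partial sum of the weights, hence at most 1; pass to the
   limit. *)
have C'B : C' `<=` unit_ball.
  move=> x [u Uu ux]; rewrite /unit_ball /=.
  have nux : (fun n => `|series (fun i => lam i *: u i) n|) @ \oo --> `|x|.
    exact: cvg_norm.
  rewrite -(cvg_lim _ nux)//; apply: limr_le.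
    by apply/cvg_ex; exists `|x|.
  near=> m; rewrite /series /= (le_trans (ler_norm_sum _ _ _))//.
  rewrite big_mkord (le_trans _ (series_nneg_le m lam0 lam1))//.
  apply: ler_sum => i _; rewrite normrZ ger0_norm// ler_piMr//.
  exact: UB (Uu i).
split => //.
  have [u Uu] : {u : nat -> V & forall i, U i (u i)}.
    by apply: (@choice nat V (fun i x => U i x)) => i; have [] := oU i.
  have /cvg_ex[x ux] := convex_series_cvg lam0 lam1 (fun i => UB i _ (Uu i)).
  by exists x, u.
move=> W oW [x [[u Uu ux] Wx]].
have [s [e [e0 eW]]] := weakly_openP oW Wx.
(* The displacement is weighted by a total of at most 1, so radius [e / 2] keeps it strictly below
   [e]. *)
pose O i := U i `&` [set y | weak_seminorm s (y - u i) < e / 2].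
have oO i : nonempty_open tau (O i).
  by apply: nonempty_open_weak_ball => //; rewrite divr_gt0.
suff main (eta : R) : 0 < eta -> delta <= diam (C' `&` W) + eta.
  by apply/ler_addgt0Pr => eta; exact: main.
move=> eta0.
have [N lamN] : exists N, delta - eta / 2 <= \sum_(i < N) lam i * delta.
  have : (fun n => series lam n * delta) @ \oo --> 1 * delta.
    by apply: cvgMl.
  move=> /cvgr_ge /(_ (delta - eta / 2)).
  rewrite mul1r ltrBlDr ltrDl divr_gt0// => /(_ isT) [N _ /(_ N (leqnn N))].
  by rewrite /series /= big_mkord mulr_suml; exists N.
(* [N] steps with this loss cost at most [eta / 2] in total; the successor avoids dividing by zero
   when [N] is 0. *)
have epsN : 0 < eta / 2 / N.+1%:R by rewrite !divr_gt0.
have [w [w' [Ow Ow' ww']]] := @spread_sum O lam _ N oO lam01 epsN.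
pose modif (v : V^nat) i := if (i < N)%N then v i else u i.
have step v : (forall i, O i (v i)) ->
    (C' `&` W) (x + \sum_(i < N) lam i *: (v i - u i)).
  move=> Ov; split.
    exists (modif v) => [i|].
      by rewrite /modif; case: ifP => // _; have [] := Ov i.
    rewrite (_ : \sum_(i < N) _ =
      \sum_(i < N) (lam i *: modif v i - lam i *: u i)).
      apply: (cvg_series_modify _ ux) => i Ni.
      by rewrite /modif ltnNge Ni.
    by apply: eq_bigr => i _; rewrite /modif ltn_ord scalerBr.
  apply: eW; rewrite /= addrC addKr.
  apply: (le_lt_trans (weak_seminorm_sum s N (fun i => lam i *: (v i - u i)))).
  apply: (@le_lt_trans _ _ (\sum_(i < N) lam i * (e / 2))).
    apply: ler_sum => i _; rewrite weak_seminormZ ger0_norm//.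
    by rewrite ler_wpM2l// ltW//; have [] := Ov i.
  rewrite -mulr_suml; have := series_nneg_le N lam0 lam1.
  move=> /(ler_wpM2r (ltW (divr_gt0 e0 (ltr0n _ 2)))).
  by move=> /le_lt_trans; apply; lra.
have := diam_ge (subset_trans (@subIsetl _ _ _) C'B) (step _ Ow) (step _ Ow').
rewrite opprD addrACA subrr add0r -sumrB.
under eq_bigr do rewrite -scalerBr opprB addrA subrK.
move=> /(le_trans ww'); rewrite -(mulr_natr _ N).
have : eta / 2 / N.+1%:R * N%:R <= eta / 2.
  by rewrite mulrAC ler_pdivrMr// ler_wpM2l ?ler_nat// divr_ge0// ltW.
move: (_ * N%:R) (\sum_(i < N) _) lamN => a b; lra.
Unshelve. all: by end_near. Qed.

Lemma convex_combination_wHD C :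
  convex_combination (nonempty_open tau) C -> wHD delta C.
Proof.
by move=> [/finite_convex_combination_countable|];
  exact: countable_convex_combination_wHD.
Qed.

End SpreadCombinations.

(** * Bregman divergence of the hypotenuse *)

Section Hypot.
Context (R : realType).
Implicit Types e g u w : R.

Definition hypot u g : R := Num.sqrt (u ^+ 2 + g ^+ 2).

Lemma hypot_ge0 u g : 0 <= hypot u g.
Proof. exact: sqrtr_ge0. Qed.

Lemma sqr_hypot u g : hypot u g ^+ 2 = u ^+ 2 + g ^+ 2.
Proof. by rewrite sqr_sqrtr// addr_ge0 ?sqr_ge0. Qed.

Lemma hypot_le u g : hypot u g <= `|u| + `|g|.
Proof.
rewrite -(@ler_pXn2r _ 2) ?nnegrE ?hypot_ge0 ?addr_ge0// sqr_hypot.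
rewrite sqrrD !real_normK ?num_real// -addrA lerD2l lerDr.
by rewrite mulrn_wge0 ?mulr_ge0.
Qed.

Lemma norm_le_hypot u g : `|u| <= hypot u g.
Proof.
rewrite -(@ler_pXn2r _ 2) ?nnegrE ?hypot_ge0// sqr_hypot real_normK ?num_real//.
by rewrite lerDl sqr_ge0.
Qed.

(** The hypotenuse is 1-Lipschitz in one leg: expand the squares and bound the cross term by
    [norm_le_hypot]. *)
Lemma hypotD u w g : hypot w g <= hypot u g + `|w - u|.
Proof.
rewrite -(@ler_pXn2r _ 2) ?nnegrE ?hypot_ge0 ?addr_ge0 ?hypot_ge0//.
rewrite sqrrD !sqr_hypot real_normK ?num_real//.
have uh := norm_le_hypot u g.
have : u * (w - u) <= hypot u g * `|w - u|.
  by rewrite (le_trans (ler_norm _))// normrM ler_wpM2r.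
by rewrite -mulr_natr; nra.
Qed.

(** The derivative of [hypot ^~ g] at [u]. When both legs vanish, the convention that the inverse of
    0 is 0 selects the subgradient 0. *)
Definition hypot_slope u g : R := u * (hypot u g)^-1.

Lemma hypot_slope_le1 u g : `|hypot_slope u g| <= 1.
Proof.
rewrite /hypot_slope normrM normfV (ger0_norm (hypot_ge0 _ _)).
have := hypot_ge0 u g; rewrite le_eqVlt => /predU1P[<-|h0].
  by rewrite invr0 mulr0.
by rewrite ler_pdivrMr// mul1r norm_le_hypot.
Qed.

(* The Bregman divergence of the convex function [hypot ^~ g]. *)
Definition hypot_gap g u w : R :=
  hypot w g - hypot u g - hypot_slope u g * (w - u).

(** Put [r = hypot u g], [s = hypot w g] and [c = u * w + g ^+ 2]. The gap times [r] is [s * r - c],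
    and Lagrange's identity gives [(s * r - c) * (s * r + c) = (g * (w - u)) ^+ 2]. Both claims
    follow from [|c| <= s * r]. *)
Lemma hypot_gap_ge g u w :
  0 <= hypot_gap g u w /\
  (g * (w - u)) ^+ 2 <= hypot_gap g u w * (hypot w g * hypot u g ^+ 2) *+ 2.
Proof.
(* If [r = 0], then [g = 0] and the slope is 0, so the gap is just [hypot w g]. *)
have := hypot_ge0 u g; rewrite le_eqVlt => /predU1P[/esym r0|r0].
  rewrite /hypot_gap /hypot_slope r0 invr0 mulr0 mul0r !subr0 hypot_ge0.
  have := sqr_hypot u g; rewrite r0 expr0n /= => /esym/eqP.
  rewrite paddr_eq0 ?sqr_ge0// !sqrf_eq0 => /andP[_ /eqP->].
  by rewrite mul0r expr0n /= !mulr0 mul0rn.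
have s0 := hypot_ge0 w g.
set r := hypot u g in r0 *; set s := hypot w g in s0 *.
have r2 : r ^+ 2 = u ^+ 2 + g ^+ 2 := sqr_hypot u g.
have s2 : s ^+ 2 = w ^+ 2 + g ^+ 2 := sqr_hypot w g.
set c := u * w + g ^+ 2.
have gapE : hypot_gap g u w * r = s * r - c.
  rewrite /hypot_gap /hypot_slope -/r -/s mulrBl mulrBl -expr2 r2.
  by rewrite mulrAC -(mulrA u) mulVf ?gt_eqF// /c; ring.
have lagrange : (s * r - c) * (s * r + c) = (g * (w - u)) ^+ 2.
  rewrite -subr_sqr exprMn s2 r2 /c; ring.
have sr0 : 0 <= s * r by rewrite mulr_ge0// ltW.
have csr : `|c| <= s * r.
  rewrite -(@ler_pXn2r _ 2) ?nnegrE// real_normK ?num_real//.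
  rewrite -subr_ge0 subr_sqr lagrange sqr_ge0 //.
have c1 : c <= s * r by apply: le_trans csr; exact: ler_norm.
split.
  by rewrite -(pmulr_lge0 _ r0) gapE subr_ge0.
rewrite -lagrange (_ : _ *+ 2 = (hypot_gap g u w * r) * (s * r *+ 2)).
  2: by ring.
rewrite gapE ler_wpM2l ?subr_ge0// mulr2n lerD2l //.
Qed.

(** Unless the minimum is already small relative to [|g| + |u|], both [|w - u|] and [|g|] exceed
    [e * hypot u g], and then the quadratic bound of [hypot_gap_ge] becomes linear in [|w - u|]. *)
Lemma min_le_hypot_gap e g u w : 0 < e <= 1 ->
  Num.min `|w - u| `|g| <= e * (`|g| + `|u|) + 4 / e ^+ 3 * hypot_gap g u w.
Proof.
move=> /andP[e0 e1]; have [gap0 gap1] := hypot_gap_ge g u w.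
have [small|] := leP (Num.min `|w - u| `|g|) (e * (`|g| + `|u|)).
  by rewrite (le_trans small)// lerDl mulr_ge0// divr_ge0// exprn_ge0// ltW.
rewrite lt_min => /andP[ke ge].
set k := `|w - u| in ke *; set r := hypot u g in gap1.
have k0 : 0 < k by apply: le_lt_trans ke; rewrite mulr_ge0 ?addr_ge0// ltW.
have rug : r <= `|g| + `|u| by rewrite addrC hypot_le.
have er : e * r <= e * (`|g| + `|u|) by rewrite ler_wpM2l// ltW.
have g0 : 0 < `|g| by apply: le_lt_trans ge; rewrite mulr_ge0 ?addr_ge0// ltW.
have r0 : 0 < r.
  by apply: lt_le_trans g0 _; rewrite /r /hypot addrC norm_le_hypot.
have eg : (e * r) ^+ 2 <= g ^+ 2.
  rewrite -(real_normK (num_real g)) ler_pXn2r ?nnegrE//.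
    by rewrite (le_trans er)// ltW.
  by rewrite mulr_ge0// ltW.
(* Replace [g] by the smaller [e * r] in [hypot_gap_ge] and cancel [r ^+ 2]. *)
have ek : (e * k) ^+ 2 <= hypot_gap g u w * hypot w g *+ 2.
  rewrite -(ler_pM2l (exprn_gt0 2 r0)).
  have : (e * r) ^+ 2 * k ^+ 2 <= g ^+ 2 * k ^+ 2 by rewrite ler_wpM2r ?sqr_ge0.
  move: gap1; rewrite exprMn -(real_normK (num_real (w - u))) -/k.
  rewrite (_ : r ^+ 2 * (e * k) ^+ 2 = (e * r) ^+ 2 * k ^+ 2); last by ring.
  rewrite (_ : r ^+ 2 * (_ *+ 2) = hypot_gap g u w * (hypot w g * r ^+ 2) *+ 2).
    by move=> H1 H2; exact: le_trans H1.
  by ring.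
(* Since [s <= r + k], [e * r <= k] and [e <= 1]. Combined with the previous bound, a factor [k]
   cancels and [e ^+ 3 * k] is at most 4 times the gap. *)
have es : e * hypot w g <= 2 * k.
  have := hypotD u w g; rewrite -/r -/k => /(ler_wpM2l (ltW e0)).
  have : e * k <= 1 * k by rewrite ler_wpM2r// ltW.
  lra.
have : (e ^+ 3 * k) * k <= (4 * hypot_gap g u w) * k.
  have : e * (e * k) ^+ 2 <= e * (hypot_gap g u w * hypot w g *+ 2).
    by rewrite ler_wpM2l// ltW.
  rewrite (_ : e * (e * k) ^+ 2 = (e ^+ 3 * k) * k); last by ring.
  move=> /le_trans; apply.
  have := ler_wpM2l gap0 es; lra.
rewrite ler_pM2r// => ek3.
rewrite ge_min -/k; apply/orP; left.
rewrite (@le_trans _ _ (4 / e ^+ 3 * hypot_gap g u w))//.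
  by rewrite mulrAC ler_pdivlMr ?exprn_gt0// mulrC.
by rewrite lerDr mulr_ge0 ?addr_ge0// ltW.
Qed.

(** With [b = lam * (w - w')], the triangle inequality for [g + b] loses at most twice
    [min(|b|, |g|)]. As [|b| <= |w - u| + |w' - u|], this minimum splits into two, each bounded by
    [min_le_hypot_gap]. *)
Lemma norm_spread e g u w w' lam : 0 < e <= 1 -> 0 <= lam <= 1 ->
  `|g| + lam * `|w - w'| <= `|g + lam * (w - w')| +
    (4 * e * (`|g| + `|u|) + 8 / e ^+ 3 * (hypot_gap g u w + hypot_gap g u w')).
Proof.
move=> e01 /andP[lam0 lam1].
have := min_le_hypot_gap g u w e01; have := min_le_hypot_gap g u w' e01.
set m := Num.min _ _; set m' := Num.min _ _ => mle m'le.
have tri : `|g| + lam * `|w - w'| <= `|g + lam * (w - w')| + 2 * (m' + m).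
  have -> : lam * `|w - w'| = `|lam * (w - w')|.
    by rewrite normrM ger0_norm.
  set b := lam * (w - w').
  have bww' : `|b| <= `|w - u| + `|w' - u|.
    rewrite /b normrM ger0_norm// (le_trans (ler_piMl _ _))//.
    by rewrite (le_trans _ (ler_normB _ _))// opprB addrA subrK.
  have m1 : Num.min `|b| `|g| <= m' + m.
    have := normr_ge0 g; have := normr_ge0 (w - u); have := normr_ge0 (w' - u).
    rewrite /m /m'; case: (leP `|b| `|g|); case: (leP `|w - u| `|g|);
      case: (leP `|w' - u| `|g|); lra.
  have : `|g| + `|b| <= `|g + b| + 2 * Num.min `|b| `|g|.
    have H1 : `|g| <= `|g + b| + `|b| by rewrite -{1}(addrK b g) ler_normB.
    have H2 : `|b| <= `|g + b| + `|g|.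
      by rewrite -{1}(addKr g b) addrC ler_normB.
    by case: (leP `|b| `|g|) => _; lra.
  by lra.
apply: (le_trans tri); rewrite lerD2l.
rewrite (_ : 8 / e ^+ 3 = 2 * (4 / e ^+ 3)).
  2: by rewrite mulrA; congr (_ / _); lra.
lra.
Qed.

End Hypot.

(** * Spreading weak neighbourhoods in L1 *)

Section L1Space.
Context d (T : measurableType d) (R : realType).
Variable mu : {measure set T -> \bar R}.
Implicit Types (f g : LfunType mu (@lexx _ _ 1%E)) (F G : L1 mu).

Lemma Lfun1_int f : mu.-integrable setT (EFin \o f).
Proof. exact/Lfun1_integrable/LfunP. Qed.

Lemma L1_pi_normE f : `|L1_pi f| = \int[mu]_x `|f x|.
Proof. by rewrite [LHS]L1_pi_norm Lnorm1. Qed.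

Lemma L1_repr_normE F : `|F| = \int[mu]_x `|L1_repr F x|.
Proof. by rewrite -[in LHS](L1_reprK F) L1_pi_normE. Qed.

Lemma L1_piD f g : L1_pi f + L1_pi g = L1_pi (f + g).
Proof. exact: L1_pi_add. Qed.

Lemma L1_piN f : - L1_pi f = L1_pi (- f).
Proof. exact: L1_pi_opp. Qed.

Lemma L1_piZ a f : a *: L1_pi f = L1_pi (a *: f).
Proof. exact: L1_pi_scale. Qed.

Lemma integrable_le (h k : T -> R) : measurable_fun setT h ->
  (forall x, `|h x| <= k x) -> mu.-integrable setT (EFin \o k) ->
  mu.-integrable setT (EFin \o h).
Proof.
move=> mh hk; apply: le_integrable => //; first exact/measurable_EFinP.
by move=> x _ /=; rewrite lee_fin (le_trans (hk x))// ler_norm.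
Qed.

Lemma ae_eq_Rintegral (h k : T -> R) :
  measurable_fun setT h -> measurable_fun setT k -> h = k %[ae mu] ->
  \int[mu]_x h x = \int[mu]_x k x.
Proof.
move=> mh mk hk; congr fine; apply: ae_eq_integral => //.
- exact/measurable_EFinP.
- exact/measurable_EFinP.
- by apply: filterS hk => x /[apply] ->.
Qed.

Section Functional.
Variable p : T -> R.
Hypothesis mp : measurable_fun setT p.
Hypothesis p1 : forall x, `|p x| <= 1.

Lemma integrable_mul_le1 (h : T -> R) : mu.-integrable setT (EFin \o h) ->
  mu.-integrable setT (EFin \o (fun x => p x * h x)).
Proof.
move=> ih; apply: (@integrable_le _ (fun x => `|h x|)).
- apply: measurable_funM => //.
  by apply/measurable_EFinP; exact: measurable_int ih.
- by move=> x; rewrite normrM ler_piMl.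
- exact: integrable_norm.
Qed.

(** Integration against [p] is dominated by the norm because [|p| <= 1], which gives continuity. *)
Lemma bounded_functional : exists phi : dual (L1 mu),
  forall F, sval phi F = \int[mu]_x (p x * L1_repr F x).
Proof.
pose phi (F : L1 mu) : R^o := \int[mu]_x (p x * L1_repr F x).
(* Independence of the representative: the chosen representative of a sum is only almost everywhere
   the sum of representatives, so linearity is checked on functions. *)
have phi_pi f : phi (L1_pi f) = \int[mu]_x (p x * f x).
  apply: ae_eq_Rintegral.
  - exact: measurable_funM.
  - exact: measurable_funM.
  - by apply: filterS (L1_pi_ae f) => x /[apply] ->.
have phi_lin : linear phi.
  move=> a F G; rewrite -(L1_reprK F) -(L1_reprK G) L1_piZ L1_piD !phi_pi.
  rewrite -[X in _ = X + _]/(a * \int[mu]_x (p x * L1_repr F x)).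
  rewrite -RintegralZl//; last exact/integrable_mul_le1/Lfun1_int.
  rewrite -RintegralD//.
  - apply: eq_Rintegral => x _ /=; rewrite mulrDr; congr (_ + _).
    exact: mulrCA.
  - have := integrable_mul_le1 (Lfun1_int (L1_repr F)).
    by move=> /(@integrableZl _ _ _ _ _ measurableT a).
  - exact/integrable_mul_le1/Lfun1_int.
have phi_le F : `|phi F| <= `|F|.
  rewrite L1_repr_normE (le_trans (le_normr_Rintegral _ _))//.
    exact/integrable_mul_le1/Lfun1_int.
  apply: le_Rintegral => //.
  - by apply: integrable_norm; exact/integrable_mul_le1/Lfun1_int.
  - by apply: integrable_norm; exact: Lfun1_int.
  - by move=> x _; rewrite normrM ler_piMl.
pose phiL : {linear L1 mu -> R^o} := HB.pack phi
  (GRing.isLinear.Build R (L1 mu) R^o *:%R phi phi_lin).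
have phi_cont : continuous (phiL : L1 mu -> R^o).
  apply: bounded_linear_continuous; exists 1; split=> // r r1.
  apply/nbhs_ballP; exists 1 => //= F.
  rewrite -ball_normE /= sub0r normrN => F1.
  exact: le_trans (phi_le F) (ltW (lt_trans F1 r1)).
by exists (exist _ phiL phi_cont).
Qed.

End Functional.

Lemma measurable_hypot (h k : T -> R) :
  measurable_fun setT h -> measurable_fun setT k ->
  measurable_fun setT (fun x => hypot (h x) (k x)).
Proof.
move=> mh mk; apply: (measurableT_comp (f := @Num.sqrt R)).
  by apply: continuous_measurable_fun; exact: sqrt_continuous.
by apply: measurable_funD; exact: measurable_funX.
Qed.

Lemma measurable_hypot_slope (h k : T -> R) :
  measurable_fun setT h -> measurable_fun setT k ->
  measurable_fun setT (fun x => hypot_slope (h x) (k x)).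
Proof.
move=> mh mk; apply: measurable_funM => //.
(* The inverse is written as the real power of exponent -1, whose measurability is at hand. *)
under eq_fun do rewrite -powR_inv1 ?hypot_ge0//.
apply: (measurableT_comp (measurable_powR _)); exact: measurable_hypot.
Qed.

Lemma integrable_hypot (h k : T -> R) :
  mu.-integrable setT (EFin \o h) -> mu.-integrable setT (EFin \o k) ->
  mu.-integrable setT (EFin \o (fun x => hypot (h x) (k x))).
Proof.
move=> ih ik; apply: (@integrable_le _ (fun x => `|h x| + `|k x|)).
- by apply: measurable_hypot; apply/measurable_EFinP;
    [exact: measurable_int ih|exact: measurable_int ik].
- by move=> x; rewrite ger0_norm ?hypot_ge0 ?hypot_le.
- exact: (integrableD measurableT (integrable_norm ih) (integrable_norm ik)).
Qed.

End L1Space.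

(** * Integrated divergence estimates and the spreading property *)

Section L1Spread.
Context d (T : measurableType d) (R : realType).
Variable mu : {measure set T -> \bar R}.
Implicit Types F G H : L1 mu.

Lemma EFin_integrableD (h k : T -> R) : mu.-integrable setT (EFin \o h) ->
  mu.-integrable setT (EFin \o k) ->
  mu.-integrable setT (EFin \o (fun x => h x + k x)).
Proof. exact: (integrableD measurableT). Qed.

Lemma EFin_integrableB (h k : T -> R) : mu.-integrable setT (EFin \o h) ->
  mu.-integrable setT (EFin \o k) ->
  mu.-integrable setT (EFin \o (fun x => h x - k x)).
Proof. exact: (integrableB measurableT). Qed.

Lemma EFin_integrableZl a (h : T -> R) : mu.-integrable setT (EFin \o h) ->
  mu.-integrable setT (EFin \o (fun x => a * h x)).
Proof. by move=> /(integrableZl measurableT a). Qed.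

Lemma measurable_L1_repr F : measurable_fun setT (L1_repr F).
Proof. exact: measurable_funPT. Qed.

Lemma L1_combination_normE G F H lam :
  `|G + lam *: (F - H)| =
  \int[mu]_x `|L1_repr G x + lam * (L1_repr F x - L1_repr H x)|.
Proof.
rewrite -{1}(L1_reprK G) -{1}(L1_reprK F) -{1}(L1_reprK H).
by rewrite L1_piN L1_piD L1_piZ L1_piD L1_pi_normE.
Qed.

Lemma L1_sub_normE F H : `|F - H| = \int[mu]_x `|L1_repr F x - L1_repr H x|.
Proof.
by rewrite -{1}(L1_reprK F) -{1}(L1_reprK H) L1_piN L1_piD L1_pi_normE.
Qed.

Definition L1_hypot G F : R := \int[mu]_x hypot (L1_repr F x) (L1_repr G x).

Lemma L1_hypot_le G F : L1_hypot G F <= `|F| + `|G|.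
Proof.
have iF := integrable_norm (Lfun1_int (L1_repr F)).
have iG := integrable_norm (Lfun1_int (L1_repr G)).
rewrite !L1_repr_normE -RintegralD//; apply: le_Rintegral => //.
- by apply: integrable_hypot; exact: Lfun1_int.
- exact: (integrableD measurableT iF iG).
- by move=> x _; exact: hypot_le.
Qed.

Definition L1_gap G F H : R :=
  \int[mu]_x hypot_gap (L1_repr G x) (L1_repr F x) (L1_repr H x).

Lemma integrable_hypot_gap G F H : mu.-integrable setT (EFin \o (fun x =>
  hypot_gap (L1_repr G x) (L1_repr F x) (L1_repr H x))).
Proof.
have iF := Lfun1_int (L1_repr F); have iG := Lfun1_int (L1_repr G).
have iH := Lfun1_int (L1_repr H).
apply: EFin_integrableB.
  by apply: EFin_integrableB; exact: integrable_hypot.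
apply: integrable_mul_le1 => [|x|]; last exact: EFin_integrableB.
  by apply: measurable_hypot_slope; exact: measurable_L1_repr.
exact: hypot_slope_le1.
Qed.

(** [phi] integrates against the slope at [F], which is bounded by 1. So the divergence from a
    near-maximiser [F] of [L1_hypot G] is small wherever [phi] is close to its value at [F], a
    weakly open condition. *)
Lemma L1_gap_functional G F : exists phi : dual (L1 mu),
  forall H, L1_gap G F H = L1_hypot G H - L1_hypot G F - sval phi (H - F).
Proof.
have mp : measurable_fun setT
    (fun x => hypot_slope (L1_repr F x) (L1_repr G x)).
  by apply: measurable_hypot_slope; exact: measurable_L1_repr.
have p1 x : `|hypot_slope (L1_repr F x) (L1_repr G x)| <= 1.
  exact: hypot_slope_le1.
have [phi phiE] := bounded_functional mu mp p1; exists phi => H.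
have iF := Lfun1_int (L1_repr F); have iG := Lfun1_int (L1_repr G).
have iH := Lfun1_int (L1_repr H).
have ihF := integrable_hypot iF iG; have ihH := integrable_hypot iH iG.
have ipF := integrable_mul_le1 mp p1 iF.
have ipH := integrable_mul_le1 mp p1 iH.
rewrite linearB /= !phiE -!RintegralB//.
- by apply: eq_Rintegral => x _; rewrite /hypot_gap mulrBr.
- exact: (integrableB measurableT ihH ihF).
- exact: (integrableB measurableT ipH ipF).
Qed.

Lemma L1_norm_spread e G F H H' lam : 0 < e <= 1 -> 0 <= lam <= 1 ->
  `|G| + lam * `|H - H'| <= `|G + lam *: (H - H')| +
    (4 * e * (`|G| + `|F|) + 8 / e ^+ 3 * (L1_gap G F H + L1_gap G F H')).
Proof.
move=> e01 lam01.
have iF := Lfun1_int (L1_repr F); have iG := Lfun1_int (L1_repr G).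
have iH := Lfun1_int (L1_repr H); have iH' := Lfun1_int (L1_repr H').
have iD := EFin_integrableB iH iH'.
have gH := integrable_hypot_gap G F H; have gH' := integrable_hypot_gap G F H'.
rewrite L1_combination_normE L1_sub_normE !L1_repr_normE /L1_gap.
(* Closure of integrability under these operations, kept in the context so that [auto] settles the
   side conditions below. *)
have iZ := EFin_integrableZl; have iA := EFin_integrableD.
have iN (h : T -> R) : mu.-integrable setT (EFin \o h) ->
    mu.-integrable setT (EFin \o (fun x => `|h x|)) by exact: integrable_norm.
rewrite -[X in _ <= _ + (_ * X + _)]RintegralD; [|by auto..].
rewrite -[X in _ <= _ + (_ + _ * X)]RintegralD; [|by auto..].
rewrite -!RintegralZl; [|by auto 10..].
rewrite -[X in _ <= _ + X]RintegralD; [|by auto 10..].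
rewrite -!RintegralD; [|by auto 10..].
apply: le_Rintegral; [by auto 10..|].
by move=> x _; exact: norm_spread.
Qed.

(** The tolerance [eps] is split in three: the term in [e] and the divergence term of
    [L1_norm_spread], and the failure to attain the diameter. *)
Lemma L1_spread (D : set (L1 mu)) (tau : Topological D) (delta : R) :
  D `<=` unit_ball -> contains_relative_weak_topology tau ->
  (forall U, nonempty_open tau U -> delta <= diam U) ->
  forall U, nonempty_open tau U ->
  forall G (lam eps : R), 0 <= lam <= 1 -> 0 < eps ->
  exists H H', [/\ U H, U H' &
    `|G| + lam * delta - eps <= `|G + lam *: (H - H')|].
Proof.
move=> D_ball tau_weak diamD U oU G lam eps lam01 eps0.
have UB F : U F -> `|F| <= 1.
  by move=> /(nonempty_open_sub oU)/D_ball.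
have G1 : 0 < 1 + `|G| by rewrite ltr_wpDr.
(* Chosen so that [4 * e * (1 + |G|) <= eps / 3]. *)
pose e := Num.min 1 (eps / (12 * (1 + `|G|))).
have e01 : 0 < e <= 1.
  by rewrite /e lt_min ge_min lexx ltr01 divr_gt0 ?mulr_gt0.
have eeps : 4 * e * (1 + `|G|) <= eps / 3.
  have : e <= eps / (12 * (1 + `|G|)) by rewrite /e ge_min lexx orbT.
  rewrite ler_pdivlMr ?mulr_gt0//; lra.
have [e0 e1] := andP e01.
have e30 : 0 < e ^+ 3 by rewrite exprn_gt0.
(* Two divergences of at most [2 * eta] each, multiplied by [8 / e ^+ 3], then give exactly
   [eps / 3]. *)
pose eta := e ^+ 3 * (eps / 96).
have eta0 : 0 < eta by rewrite mulr_gt0 ?divr_gt0.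
have supU : has_sup [set L1_hypot G F | F in U].
  split; first by have [[F UF] _] := oU; exists (L1_hypot G F), F.
  exists (1 + `|G|) => _ [F UF <-].
  by rewrite (le_trans (L1_hypot_le _ _))// lerD2r UB.
have [_ [F UF <-] Fsup] := sup_adherent eta0 supU.
have [phi phiE] := L1_gap_functional G F.
pose U' := U `&` [set H | weak_seminorm [:: phi] (H - F) < eta].
have oU' : nonempty_open tau U' by exact: nonempty_open_weak_ball.
(* One [eta] comes from near-maximality of [F] on [U], the other from the bound on [phi (H - F)]. *)
have gap_le H : U' H -> L1_gap G F H <= eta *+ 2.
  move=> [UH]; rewrite /= /weak_seminorm big_seq1 => phiH.
  have : L1_hypot G H <= sup [set L1_hypot G F | F in U].
    by apply: ub_le_sup; [case: supU|exists H].
  have := ler_norm (- sval phi (H - F)); rewrite normrN.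
  rewrite phiE mulr2n; lra.
have supU' : has_sup [set `|x.1 - x.2| | x in U' `*` U'].
  split; first by have [[H U'H] _] := oU'; exists `|H - H|, (H, H).
  exists 2 => _ [[H H'] [[/UB H1 _] [/UB H'1 _]] <-].
  by rewrite (le_trans (ler_normB _ _))// -[2]/(1 + 1) lerD.
have eps3 : 0 < eps / 3 by rewrite divr_gt0.
have [_ [[H H'] /= [U'H U'H'] <-] HH'] := sup_adherent eps3 supU'.
exists H, H'; split; [by case: U'H|by case: U'H'|].
have := L1_norm_spread G F H H' e01 lam01.
have : 8 / e ^+ 3 * (L1_gap G F H + L1_gap G F H') <= eps / 3.
  rewrite mulrAC ler_pdivrMr//.
  by have := gap_le _ U'H; have := gap_le _ U'H'; rewrite /eta; lra.
have : 4 * e * (`|G| + `|F|) <= 4 * e * (1 + `|G|).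
  apply: ler_wpM2l; first by rewrite mulr_ge0// ltW.
  by rewrite [leRHS]addrC lerD2l UB.
have : lam * (delta - eps / 3) <= lam * `|H - H'|.
  have /andP[lam0 _] := lam01; rewrite ler_wpM2l//.
  by rewrite (le_trans _ (ltW HH'))// lerD2r; exact: diamD.
have : lam * (eps / 3) <= eps / 3.
  by have /andP[_ lam1] := lam01; rewrite ler_piMl// ltW.
lra.
Qed.

End L1Spread.

(** * Completeness of L1 *)

Section L1Complete.
Context d (T : measurableType d) (R : realType).
Variable mu : {measure set T -> \bar R}.

Lemma summable_partial_sums_cvg (a : R^nat) :
  (\sum_(i <oo) (`|a i|)%:E < +oo)%E -> cvgn (series a).
Proof.
move=> aoo; apply: normed_cvg; apply: nondecreasing_is_cvgn.
  by apply: nondecreasing_series => n _ _; exact: normr_ge0.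
exists (fine (\sum_(i <oo) (`|a i|)%:E)%E) => _ [n _ <-].
rewrite -lee_fin fineK.
  rewrite /series /= -sumEFin; apply: nneseries_lim_ge => i _ _.
  by rewrite lee_fin.
by rewrite ge0_fin_numE// nneseries_ge0// => i _ _; rewrite lee_fin.
Qed.

Lemma Lfun_sumE (h : nat -> LfunType mu (@lexx _ _ 1%E)) n x :
  (\sum_(i < n) h i) x = \sum_(i < n) h i x.
Proof.
elim: n => [|n IH]; first by rewrite !big_ord0.
by rewrite !big_ord_recr /= -IH.
Qed.

Lemma L1_pi_series (h : nat -> LfunType mu (@lexx _ _ 1%E)) n :
  series (fun i => L1_pi (h i)) n = L1_pi (\sum_(i < n) h i).
Proof.
rewrite /series /= big_mkord; elim: n => [|n IH]; first by rewrite !big_ord0.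
by rewrite !big_ord_recr /= IH L1_piD.
Qed.

(** The Riesz-Fischer argument: the sum [G] of the absolute values is integrable by monotone
    convergence, hence finite almost everywhere. The series then converges pointwise there, and [G]
    dominates its partial sums. *)
Lemma L1_normed_cvg (u : (L1 mu)^nat) :
  (\sum_(i <oo) (`|u i|)%:E < +oo)%E -> cvgn (series u).
Proof.
move=> uoo; pose h i := L1_repr (u i).
have mh i : measurable_fun setT (h i) by exact: measurable_L1_repr.
pose S n x : R := \sum_(0 <= i < n) h i x.
have mS n : measurable_fun setT (EFin \o S n).
  apply/measurable_EFinP; rewrite /S; exact: measurable_sum.
pose G x := (\sum_(i <oo) (`|h i x|)%:E)%E.
have G0 x : (0 <= G x)%E by apply: nneseries_ge0 => i _ _; rewrite lee_fin.
have mnh i : measurable_fun setT (fun x => (`|h i x|)%:E).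
  by apply/measurable_EFinP; exact: measurableT_comp.
have iG : mu.-integrable setT G.
  apply/integrableP; split.
    by apply: ge0_emeasurable_sum => // i x _ _; rewrite lee_fin.
  under eq_integral do rewrite gee0_abs//.
  rewrite integral_nneseries//.
  apply: le_lt_trans uoo; apply: lee_nneseries => [i _ _|i _].
    by rewrite integral_ge0// => x _; rewrite lee_fin.
  rewrite L1_repr_normE /Rintegral fineK//.
  apply: integrable_fin_num => //; exact: (integrable_norm (Lfun1_int (h i))).
(* The upper limit is measurable and defined everywhere; it agrees with the pointwise limit almost
   everywhere, and [fine] sends infinite values to 0. *)
pose L x := limn_esup (fun n => (S n x)%:E).
have mL : measurable_fun setT (EFin \o (fine \o L)).
  apply/measurable_EFinP; apply: measurableT_comp.
    exact: fine_measurable.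
  exact: measurable_fun_limn_esup.
have SL : {ae mu, forall x, setT x ->
    (fun n => (EFin \o S n) x) @ \oo --> (EFin \o (fine \o L)) x}.
  apply: filterS (integrable_ae measurableT iG) => x /(_ I) Gx _.
  have /cvg_ex[l Sl] : cvgn (series (fun i => h i x)).
    by apply: summable_partial_sums_cvg; rewrite ltey_eq Gx.
  have SlE : (fun n => (S n x)%:E) @ \oo --> l%:E.
    by apply: cvg_EFin => //; exact: nearW.
  by rewrite /= /L (cvg_limn_einf_sup SlE).2.
have SG : {ae mu, forall x n, setT x -> (`|(EFin \o S n) x| <= G x)%E}.
  apply: aeW => x n _ /=.
  apply: (@le_trans _ _ (\sum_(0 <= i < n) (`|h i x|)%:E)%E).
    by rewrite sumEFin lee_fin ler_norm_sum.
  by apply: nneseries_lim_ge => i _ _; rewrite lee_fin.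
have [iL SL0 _] := dominated_convergence measurableT mS mL SL iG SG.
have Lf : fine \o L \in Lfun mu 1 by exact/Lfun1_integrable.
pose Lfn := Lfun_Sub (@lexx _ _ 1%E) Lf.
apply/cvg_ex; exists (L1_pi Lfn); apply/subr_cvg0/norm_cvg0P.
rewrite [X in X @ _ --> _](_ : _ =
    fine \o (fun n =>
      \int[mu]_x `|(EFin \o S n) x - (EFin \o (fine \o L)) x|)%E).
  exact: fine_cvg SL0.
apply/funext => n /=.
have -> : series u n = L1_pi (\sum_(i < n) h i).
  rewrite -L1_pi_series; congr (series _ n); apply/funext => i.
  by rewrite L1_reprK.
rewrite L1_piN L1_piD L1_pi_normE /Rintegral; congr fine.
apply: eq_integral => x _ /=; congr (`|_ - _|)%:E.
by rewrite Lfun_sumE /S big_mkord.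
Qed.

Lemma L1_convex_series_cvg (lam : R^nat) (u : (L1 mu)^nat) :
  (forall i, 0 <= lam i) -> series lam @ \oo --> (1 : R) ->
  (forall i, unit_ball (u i)) ->
  cvgn (series (fun i => lam i *: u i)).
Proof.
move=> lam0 lam1 u1; apply: L1_normed_cvg.
apply: (@le_lt_trans _ _ 1%:E); last exact: ltry.
apply: lime_le; first by apply: is_cvg_nneseries => i _ _; rewrite lee_fin.
near=> n; rewrite sumEFin lee_fin big_mkord.
rewrite (le_trans _ (series_nneg_le n lam0 lam1))//.
by apply: ler_sum => i _; rewrite normrZ ger0_norm// ler_piMr//; exact: u1.
Unshelve. all: by end_near. Qed.

End L1Complete.

Theorem corollary1p3 (R : realType) (d : measure_display)
    (Omega : measurableType d) (mu : {measure set Omega -> \bar R})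
    (D : set (L1 mu)) (tau : Topological D)
    (D_ball : D `<=` unit_ball) (D_neq0 : D !=set0)
    (tau_weak : contains_relative_weak_topology tau) :
  (forall delta : R, 0 < delta -> delta <= 2 ->
     (forall U, nonempty_open tau U -> delta <= diam U) ->
     forall C, convex_combination (nonempty_open tau) C -> wHD (delta / 4) C)
  /\
  ((forall U, nonempty_open tau U -> diam U = 2) ->
     forall C, convex_combination (nonempty_open tau) C -> wHD 2 C).
Proof.
have wHD_diam (delta : R) :
    (forall U, nonempty_open tau U -> delta <= diam U) ->
    forall C, convex_combination (nonempty_open tau) C -> wHD delta C.
  move=> diamD C; apply: convex_combination_wHD => //.
    exact: L1_spread.
  exact: L1_convex_series_cvg.
split=> [delta delta0 _ diamD C CC|diamD C]; last first.
  by apply: wHD_diam => U /diamD ->.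
have [C0 CB CW] := wHD_diam _ diamD C CC.
split=> // W oW CW0; apply: le_trans (CW W oW CW0).
(* Positivity of [delta] gives [delta / 4 <= delta]. *)
by rewrite ler_pdivrMr//; lra.
Qed.
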